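(* (a) Let $(X_i)_{i\ge1}$ be an i.i.d. sequence of real-valued random variables with a symmetric distribution, i.e. $X_i$ and $-X_i$ have the same law, and let $S_n=\sum_{i=1}^n X_i$. Then $$P(\operatorname{sgn}(S_n)\neq\operatorname{sgn}(S_{n-1}))=O(n^{-1/2})\quad (n\to\infty),$$ where the implied constant may depend on the distribution of $X_1$, and for every $n\ge 1$ $$P(\operatorname{sgn}(S_n)\neq\operatorname{sgn}(S_{n-1}))\ge \frac{1}{2n}\left(1-P(X_1=0)^n\right).$$ (b) The lower bound is sharp in the following sense: there exists a symmetric probability distribution on $\mathbb{R}$ such that, if $(X_i)_{i\ge1}$ are i.i.d. with this distribution and $S_n=\sum_{i=1}^n X_i$, then $$P(\operatorname{sgn}(S_n)\neq\operatorname{sgn}(S_{n-1}))=\frac{1}{2n}+o\left(\frac1n\right)\quad (n\to\infty).$$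
   Context: Convention: $S_0=0$, and $\operatorname{sgn}:\mathbb{R}\to\{-1,0,1\}$ is the usual sign function, with $\operatorname{sgn}(0)=0$. *)

(* Defs.v *)
From HB Require Import structures.
From mathcomp Require Import all_boot all_order all_algebra finmap.
From mathcomp Require Import all_classical all_reals all_analysis.
Set Implicit Arguments.
Unset Strict Implicit.
Unset Printing Implicit Defensive.
Import Order.TTheory GRing.Theory Num.Theory.
Import numFieldNormedType.Exports.

Local Open Scope classical_set_scope.
Local Open Scope ring_scope.

(* Laws are compared on measurable sets only: a measure is here a function on
   all sets, whose values on non-measurable sets carry no information. *)
Definition symmetric_law (R : realType) (mu : probability R R) : Prop :=
  forall A : set R, measurable A -> pushforward mu -%R A = mu A.

Definition mutually_independent (d : measure_display) (T : measurableType d)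
    (R : realType) (P : probability T R) (I : choiceType)
    (X : I -> {RV P >-> R}) : Prop :=
  forall (J : {fset I}) (A : I -> set R), (forall i, measurable (A i)) ->
    (P (\bigcap_(i in [set` J]) (X i @^-1` A i)) =
     \prod_(i <- J) P (X i @^-1` A i))%E.

Definition iid_with_law (d : measure_display) (T : measurableType d)
    (R : realType) (P : probability T R) (X : nat -> {RV P >-> R})
    (mu : probability R R) : Prop :=
  mutually_independent X /\
  forall i (A : set R), measurable A -> distribution P (X i) A = mu A.

(* [X i] is the step of index i + 1, so that this is X_1 + ... + X_n, and 0
   when n = 0. *)
Definition partial_sum (d : measure_display) (T : measurableType d)
    (R : realType) (P : probability T R) (X : nat -> {RV P >-> R})
    (n : nat) (t : T) : R :=
  \sum_(i < n) X i t.

(* Only meaningful for 1 <= n, since 0.-1 = 0. *)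
Definition sign_change_prob (d : measure_display) (T : measurableType d)
    (R : realType) (P : probability T R) (X : nat -> {RV P >-> R})
    (n : nat) : R :=
  fine (P [set t | Num.sg (partial_sum X n t) !=
                   Num.sg (partial_sum X n.-1 t)]).

(* Main.v *)
Require Import Defs.
From HB Require Import structures.
From mathcomp Require Import all_boot all_order all_algebra finmap perm.
From mathcomp Require Import all_classical all_reals all_analysis measurable_realfun.
From mathcomp Require Import ring lra.
Set Implicit Arguments.
Unset Strict Implicit.
Unset Printing Implicit Defensive.
Import Order.TTheory GRing.Theory Num.Theory.
Import numFieldNormedType.Exports.

Local Open Scope classical_set_scope.
Local Open Scope ring_scope.

(** Write S for S_n and call step k pivotal when removing X_k from S changes
    the sign of S. The law of (X_1, ..., X_n) is invariant under permutations
    and under flipping the signs of some coordinates: on boxes this is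
    independence together with the symmetry of the common law, and boxes
    generate the product sigma-algebra (signed_steps_law). Hence, whatever signs
    are given to the steps, each step is pivotal with the probability
    p = P(sgn S_n <> sgn S_(n-1)) (Pr_sign_changes).

    Lower bound in (a). Flip the signs of the steps one at a time, in order,
    from S to -S, removing each step just before it comes back with the
    opposite sign. This chain has 2n transitions. If none of them changes the
    sign of the current sum, then S and -S have the same sign, so all the sums
    vanish, and so do all the steps (sign_chain). Each transition changes the
    sign with probability p, so 2 n p >= 1 - P(X_1 = 0)^n
    (sign_change_prob_ge).

    Upper bound in (a). Given |X_n| and S_(n-1), comparing the two signs of X_n
    gives p <= E[sgn S_n sgn X_n] (sgr_flip_le). By exchangeability the right
    side is E[sgn S_n W] / n, where W is the sum of the n signs sgn X_k. The
    signs are uncorrelated, so E[W^2] <= n and p <= n^(-1/2)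
    (sign_change_prob_le).

    Part (b). Take X = sgn(U) exp(|U|^(-10)) with U uniform on [-1, 1]. The lower
    bound comes from (a). Put the n values |U_k| on a grid of mesh n^(-4). Outside
    an event of probability O(n^(-2)), these values differ pairwise by at least
    one mesh, and some |U_k| with k < n is at most n^(-1/2). Then the smallest
    |U_k| yields a step larger in absolute value than n times any other
    (exists_dominant), and so it decides the sign of S_n; likewise, the smallest
    |U_k| with k < n decides the sign of S_(n-1). The sign can then change only
    if X_n is the largest of the n steps in absolute value and is opposite to
    S_(n-1) (sign_change_cases), which has probability at most 1/(2n) by
    exchangeability and symmetry (Pr_opposed_leader_le). *)

(** * Expectations of bounded functions and probabilities of boolean events *)

Section bounded_expectation.
Context (d : measure_display) (T : measurableType d) (R : realType)
  (P : probability T R).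
Implicit Types (f g : T -> R) (b c : T -> bool).

(** Every function integrated below is bounded, so that on a probability space
    integrability never needs a separate argument. *)
Definition bounded_meas f :=
  measurable_fun setT f /\ exists M, forall t, `|f t| <= M.

Definition Ex f : R := \int[P]_t f t.

Definition Pr b : R := fine (P [set t | b t]).

Lemma bounded_meas_integrable f : bounded_meas f ->
  P.-integrable setT (EFin \o f).
Proof.
move=> [mf [M fM]]; apply: measurable_bounded_integrable => //.
  by rewrite ltey_eq; apply/orP; left; exact: fin_num_measure.
exists M; split; first exact: num_real.
by move=> x Mx t _ /=; apply: (le_trans (fM t)); exact: ltW.
Qed.

Lemma bounded_meas_cst r : bounded_meas (fun=> r).
Proof. by split; [exact: measurable_cst | exists `|r|]. Qed.

Lemma bounded_measD f g :
  bounded_meas f -> bounded_meas g -> bounded_meas (fun t => f t + g t).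
Proof.
move=> [mf [M fM]] [mg [N gN]]; split; first exact: measurable_funD.
by exists (M + N) => t; apply: (le_trans (ler_normD _ _)); exact: lerD.
Qed.

Lemma bounded_measM f g :
  bounded_meas f -> bounded_meas g -> bounded_meas (fun t => f t * g t).
Proof.
move=> [mf [M fM]] [mg [N gN]]; split; first exact: measurable_funM.
by exists (M * N) => t; rewrite normrM; exact: ler_pM.
Qed.

Lemma bounded_meas_sum (I : Type) (r : seq I) (F : I -> T -> R) :
  (forall i, bounded_meas (F i)) -> bounded_meas (fun t => \sum_(i <- r) F i t).
Proof.
move=> bF; elim: r => [|i r IHr].
  by under eq_fun do rewrite big_nil; exact: bounded_meas_cst.
by under eq_fun do rewrite big_cons; exact: bounded_measD.
Qed.

Lemma bounded_meas_pred b :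
  measurable_fun setT b -> bounded_meas (fun t => (b t)%:R).
Proof.
move=> mb; split; last by exists 1 => t; case: (b t); rewrite ?normr1 ?normr0.
have -> : (fun t => (b t)%:R) = (fun t => if b t then 1 else 0) :> (T -> R).
  by apply/funext => t; case: (b t).
by apply: measurable_fun_if => //; exact: measurable_cst.
Qed.

Lemma measurable_pred_set b : measurable_fun setT b -> measurable [set t | b t].
Proof.
move=> mb; have := mb measurableT [set true] I; rewrite setTI.
by congr measurable; apply/seteqP; split => t.
Qed.

Lemma measurable_forall (I : finType) (b : I -> T -> bool) :
  (forall i, measurable_fun setT (b i)) ->
  measurable_fun setT (fun t => [forall i, b i t]).
Proof.
move=> mb; rewrite (_ : (fun t => _) = fun t => all (b^~ t) (enum I)).
  by elim: (enum I) => //= i r IHr; exact: measurable_and.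
apply/funext => t; apply/forallP/allP => [bt i _|bt i]; first exact: bt.
by apply: bt; rewrite mem_enum.
Qed.

Lemma measurable_exists (I : finType) (b : I -> T -> bool) :
  (forall i, measurable_fun setT (b i)) ->
  measurable_fun setT (fun t => [exists i, b i t]).
Proof.
move=> mb; rewrite (_ : (fun t => _) = fun t => ~~ [forall i, ~~ b i t]).
  by apply: measurable_neg; apply: measurable_forall => i; exact: measurable_neg.
by apply/funext => t; rewrite negb_forall; apply: eq_existsb => i; rewrite negbK.
Qed.

Lemma Ex_cst r : Ex (fun=> r) = r.
Proof. by rewrite /Ex Rintegral_cst// [X in fine X]probability_setT mulr1. Qed.

Lemma le_Ex f g : bounded_meas f -> bounded_meas g ->
  (forall t, f t <= g t) -> Ex f <= Ex g.
Proof.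
by move=> bf bg fg; apply: le_Rintegral => //; exact: bounded_meas_integrable.
Qed.

Lemma ExD f g : bounded_meas f -> bounded_meas g ->
  Ex (fun t => f t + g t) = Ex f + Ex g.
Proof. by move=> bf bg; apply: RintegralD => //; exact: bounded_meas_integrable. Qed.

Lemma ExZ r f : bounded_meas f -> Ex (fun t => r * f t) = r * Ex f.
Proof. by move=> bf; apply: RintegralZl => //; exact: bounded_meas_integrable. Qed.

Lemma Ex_sum (I : Type) (r : seq I) (F : I -> T -> R) :
  (forall i, bounded_meas (F i)) ->
  Ex (fun t => \sum_(i <- r) F i t) = \sum_(i <- r) Ex (F i).
Proof.
move=> bF; elim: r => [|i r IHr].
  by under [X in Ex X]eq_fun do rewrite big_nil; rewrite Ex_cst big_nil.
under [X in Ex X]eq_fun do rewrite big_cons.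
by rewrite ExD ?IHr ?big_cons//; exact: bounded_meas_sum.
Qed.

Lemma Ex_pred b : measurable_fun setT b -> Ex (fun t => (b t)%:R) = Pr b.
Proof.
move=> mb; rewrite /Ex /Pr /Rintegral -(setIT [set t | b t]).
rewrite -integral_indic//; last exact: measurable_pred_set.
congr fine; apply: eq_integral => t _; rewrite indicE; congr (_%:R%:E).
by case: (boolP (b t)) => bt; [rewrite mem_set | rewrite memNset//; exact/negP].
Qed.

Lemma EFin_Pr b : measurable_fun setT b -> (Pr b)%:E = P [set t | b t].
Proof.
move=> mb; rewrite /Pr fineK// fin_num_measure//; exact: measurable_pred_set.
Qed.

Lemma Pr_le1 b : measurable_fun setT b -> Pr b <= 1.
Proof.
move=> mb; rewrite -Ex_pred// -[leRHS]Ex_cst; apply: le_Ex.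
- exact: bounded_meas_pred.
- exact: bounded_meas_cst.
- by move=> t; case: (b t).
Qed.

(** Union bounds are stated through sums of indicators, which covers both
    coverings and, in Pr_ge_sum, disjoint families. *)
Lemma Pr_le_sum (I : Type) (r : seq I) b (c : I -> T -> bool) :
  measurable_fun setT b -> (forall i, measurable_fun setT (c i)) ->
  (forall t, (b t)%:R <= \sum_(i <- r) (c i t)%:R :> R) ->
  Pr b <= \sum_(i <- r) Pr (c i).
Proof.
move=> mb mc bc.
have bmc i : bounded_meas (fun t => (c i t)%:R) by exact: bounded_meas_pred.
rewrite -Ex_pred//; under eq_bigr do rewrite -Ex_pred//.
rewrite -Ex_sum//; apply: le_Ex => //; first exact: bounded_meas_pred.
exact: bounded_meas_sum.
Qed.

Lemma le_Pr b c : measurable_fun setT b -> measurable_fun setT c ->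
  (forall t, b t -> c t) -> Pr b <= Pr c.
Proof.
move=> mb mc bc; rewrite -!Ex_pred//; apply: le_Ex; try exact: bounded_meas_pred.
by move=> t; have := bc t; case: (b t) => [->//|_]; exact: ler0n.
Qed.

Lemma Pr_or_le b c : measurable_fun setT b -> measurable_fun setT c ->
  Pr (fun t => b t || c t) <= Pr b + Pr c.
Proof.
move=> mb mc.
have := @Pr_le_sum bool [:: true; false] (fun t => b t || c t)
  (fun i => if i then b else c).
rewrite !big_cons big_nil addr0; apply.
- exact: measurable_or.
- by case.
- move=> t; rewrite !big_cons big_nil addr0.
  by case: (b t); case: (c t); rewrite /= ?addr0 ?add0r// lerDl.
Qed.

Lemma Pr_exists_le (I : finType) (b : I -> T -> bool) :
  (forall i, measurable_fun setT (b i)) ->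
  Pr (fun t => [exists i, b i t]) <= \sum_i Pr (b i).
Proof.
move=> mb; apply: Pr_le_sum => // [|t]; first exact: measurable_exists.
have [/existsP[i bi]|_] := boolP [exists i, b i t]; last exact: sumr_ge0.
by rewrite (bigD1 i)//= bi lerDl sumr_ge0.
Qed.

Lemma Pr_ge_sum (I : Type) (r : seq I) b (c : I -> T -> bool) :
  measurable_fun setT b -> (forall i, measurable_fun setT (c i)) ->
  (forall t, \sum_(i <- r) (c i t)%:R <= (b t)%:R :> R) ->
  \sum_(i <- r) Pr (c i) <= Pr b.
Proof.
move=> mb mc bc.
have bmc i : bounded_meas (fun t => (c i t)%:R) by exact: bounded_meas_pred.
rewrite -Ex_pred//; under eq_bigr do rewrite -Ex_pred//.
rewrite -Ex_sum//; apply: le_Ex => //; last exact: bounded_meas_pred.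
exact: bounded_meas_sum.
Qed.

End bounded_expectation.

(** * Invariance of the law of the steps *)

Section tuple_law.
Context (R : realType) (n : nat).

Definition box (A : 'I_n -> set R) : set (n.-tuple R) :=
  [set x | forall i, A i (tnth x i)].

Definition boxes : set (set (n.-tuple R)) :=
  [set box A | A in [set A | forall i, measurable (A i)]].

Lemma measurable_box A : (forall i, measurable (A i)) -> measurable (box A).
Proof.
move=> mA.
have -> : box A = \bigcap_(i in [set: 'I_n]) ((@tnth n R)^~ i @^-1` A i).
  by apply/seteqP; split=> [x Ax i _|x Ax i]; [exact: Ax|exact: (Ax i I)].
apply: fin_bigcap_measurable => // i _; rewrite -[X in measurable X]setTI.
exact: measurable_tnth.
Qed.

Lemma sub_boxes (B : set (n.-tuple R)) : measurable B -> <<s boxes >> B.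
Proof.
apply: smallest_sub; first exact: smallest_sigma_algebra.
rewrite -bigcup_seq => C [i _ [A mA <-]]; apply: sub_sigma_algebra.
exists (fun j => if j == i then A else setT) => [j /=|]; first by case: ifP.
rewrite setTI; apply/seteqP; split=> [x /(_ i)|x Ax j]; first by rewrite eqxx.
by case: eqP => // ->.
Qed.

(** Boxes form a pi-system that generates the product sigma-algebra, so the
    uniqueness theorem for finite measures applies to the two image laws. *)
Lemma eq_law_boxes (d : measure_display) (T : measurableType d)
    (P : probability T R) (f g : T -> n.-tuple R) (B : set (n.-tuple R)) :
  measurable_fun setT f -> measurable_fun setT g ->
  (forall A, (forall i, measurable (A i)) ->
    P (f @^-1` box A) = P (g @^-1` box A)) ->
  measurable B -> P (f @^-1` B) = P (g @^-1` B).
Proof.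
move=> mf mg fg /sub_boxes sB.
pose F : {mfun T >-> n.-tuple R} := HB.pack f (isMeasurableFun.Build _ _ _ _ _ mf).
pose G : {mfun T >-> n.-tuple R} := HB.pack g (isMeasurableFun.Build _ _ _ _ _ mg).
rewrite -[LHS]/(distribution P F B) -[RHS]/(distribution P G B).
apply: (g_sigma_algebra_measure_unique boxes _ (fun=> setT)) => //.
- by move=> _ [A mA <-]; exact: measurable_box.
- by move=> _; exists (fun=> setT) => //; apply/seteqP; split.
- by rewrite bigcup_const//; exists 0%N.
- move=> _ _ [A mA <-] [A' mA' <-]; exists (fun i => A i `&` A' i) => /=.
    by move=> i; exact: measurableI.
  apply/seteqP; split=> [x Ax|x [Ax A'x] i]; last by split.
  by split=> i; have [] := Ax i.
- by move=> _ [A mA <-]; exact: fg.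
- by move=> _; rewrite [X in (X < _)%E]probability_setT ltry.
Qed.

End tuple_law.

Section iid.
Context (d : measure_display) (T : measurableType d) (R : realType)
  (P : probability T R) (X : nat -> {RV P >-> R}) (mu : probability R R).
Hypothesis Xmu : iid_with_law X mu.

(** Mutual independence is a product rule over finite sets of indices; an
    injective reindexing s turns it into one over the coordinates of a vector. *)
Lemma iid_box n (s : 'I_n -> nat) (A : 'I_n -> set R) :
  injective s -> (forall i, measurable (A i)) ->
  P [set t | forall i, A i (X (s i) t)] = (\prod_(i < n) mu (A i))%E.
Proof.
move=> s_inj mA; have [indX lawX] := Xmu.
(* The set attached to the index k is A i when k = s i, and everything when k is
   not a value of s. *)
pose B k := \bigcap_(i in [set i | s i = k]) A i.
have mB k : measurable (B k) by apply: fin_bigcap_measurable.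
have Bs i : B (s i) = A i.
  by apply/seteqP; split=> [x /(_ i erefl)//|x Ax j /= /s_inj ->].
have -> : [set t | forall i, A i (X (s i) t)] =
    \bigcap_(k in [set` [fset s i | i in 'I_n]%fset]) (X k @^-1` B k).
  apply/seteqP; split=> [t At k /=|t Bt i].
    by move=> /imfsetP[i _ ->]; rewrite Bs; exact: At.
  by have := Bt (s i); rewrite /= Bs; apply; apply/imfsetP; exists i.
rewrite indX// big_imfset/=; last by move=> i j _ _; exact: s_inj.
rewrite big_enum/=; apply: eq_bigr => i _; rewrite Bs.
exact: lawX.
Qed.

Hypothesis mu_sym : symmetric_law mu.

Definition signed_steps n (e : 'I_n -> bool) (s : 'I_n -> nat) (t : T) :
  n.-tuple R := [tuple (-1) ^+ e i * X (s i) t | i < n].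

Lemma measurable_signed_steps n (e : 'I_n -> bool) (s : 'I_n -> nat) :
  measurable_fun setT (signed_steps e s).
Proof.
apply/measurable_fun_tnthP => i.
rewrite (_ : _ \o _ = fun t => (-1) ^+ e i * X (s i) t).
  exact: measurable_funM.
by apply/funext => t /=; rewrite tnth_mktuple.
Qed.

Lemma signed_steps_box n (e : 'I_n -> bool) (s : 'I_n -> nat) A :
  injective s -> (forall i, measurable (A i)) ->
  P (signed_steps e s @^-1` box A) = (\prod_(i < n) mu (A i))%E.
Proof.
move=> s_inj mA; pose B i := ( *%R ((-1) ^+ e i)) @^-1` A i.
have mB i : measurable (B i).
  by rewrite /B -[X in measurable X]setTI; exact: mulrl_measurable.
rewrite (_ : _ @^-1` _ = [set t | forall i, B i (X (s i) t)]).
  rewrite iid_box//; apply: eq_bigr => i _.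
  rewrite /B; case: (e i); last first.
    by congr (mu _); apply/seteqP; split => x; rewrite /= expr0 mul1r.
  rewrite -[RHS]mu_sym//; congr (mu _).
  by apply/seteqP; split => x; rewrite /= expr1 mulN1r.
apply/seteqP; split=> t /= + i => /(_ i).
  by rewrite /B tnth_mktuple.
by rewrite /box/= tnth_mktuple.
Qed.

(** A box has the same probability for every choice of signs and of distinct
    indices, because a symmetric law gives the same mass to A and to -A. *)
Lemma signed_steps_law n (e e' : 'I_n -> bool) (s s' : 'I_n -> nat) B :
  injective s -> injective s' -> measurable B ->
  P (signed_steps e s @^-1` B) = P (signed_steps e' s' @^-1` B).
Proof.
move=> s_inj s'_inj mB.
apply: eq_law_boxes => // [||A mA]; try exact: measurable_signed_steps.
by rewrite !signed_steps_box.
Qed.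

End iid.

(** * Signs of sums *)

Section signs.
Context (R : realType).
Implicit Types x y : R.

Lemma measurable_sgr : measurable_fun setT (Num.sg : R -> R).
Proof.
have -> : (Num.sg : R -> R) =
    (fun x => if x == 0 then 0 else if x < 0 then -1 else 1) by apply/funext.
apply: measurable_fun_ifT => //.
  exact: measurable_fun_eqr.
by apply: measurable_fun_ifT => //; exact: measurable_fun_ltr.
Qed.

(** With x = S_(n-1) and y = X_n, this compares, for the two signs of the last
    step, the number of sign changes with the total correlation between the sign
    of the sum and the sign of that step. If 0 < |x| < |y| the two sides are 1
    and 2; if |x| = |y| <> 0 both are 1; if x = 0 <> y both are 2; in the other
    cases both are 0. *)
Lemma sgr_flip_le x y :
  (Num.sg (x + y) != Num.sg x)%:R + (Num.sg (x - y) != Num.sg x)%:R <=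
  Num.sg (x + y) * Num.sg y + Num.sg (x - y) * Num.sg (- y) :> R.
Proof.
have e1 : (1 == -1 :> R) = false by apply/eqP => h; lra.
have e2 : (-1 == 1 :> R) = false by apply/eqP => h; lra.
have e3 : (1 == 0 :> R) = false by apply/eqP => h; lra.
have e4 : (0 == 1 :> R) = false by apply/eqP => h; lra.
have e5 : (-1 == 0 :> R) = false by apply/eqP => h; lra.
have e6 : (0 == -1 :> R) = false by apply/eqP => h; lra.
rewrite sgrN.
case: (sgrP x) => hx; case: (sgrP y) => hy;
case: (sgrP (x + y)) => h1; case: (sgrP (x - y)) => h2;
rewrite ?eqxx ?e1 ?e2 ?e3 ?e4 ?e5 ?e6 /=; lra.
Qed.

Lemma sgr_eq_of_mul_ge0 x y : x != 0 -> y != 0 ->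
  ~~ (Num.sg x * Num.sg y < 0) -> Num.sg x = Num.sg y.
Proof.
rewrite -sgrM sgr_lt0 -leNgt.
move=> x0 y0; case: (ltgtP x 0) x0 => // hx _; case: (ltgtP y 0) y0 => // hy _.
- by rewrite !ltr0_sg.
- by rewrite leNgt nmulr_rlt0// hy.
- by rewrite leNgt pmulr_rlt0// hy.
- by rewrite !gtr0_sg.
Qed.

End signs.

Section tuple_signs.
Context (R : realType) (m : nat).
Implicit Type x : m.+1.-tuple R.

Definition tuple_sum x : R := \sum_i tnth x i.

(** For k = ord_max the difference is S_(n-1) and this is the event of interest;
    the other k are its images under exchangeability. *)
Definition sign_changes (k : 'I_m.+1) x :=
  Num.sg (tuple_sum x) != Num.sg (tuple_sum x - tnth x k).

Definition sign_agreement (k : 'I_m.+1) x : R :=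
  Num.sg (tuple_sum x) * Num.sg (tnth x k).

Lemma measurable_tuple_sum : measurable_fun setT tuple_sum.
Proof. by apply: measurable_sum => i; exact: measurable_tnth. Qed.

Lemma measurable_sign_changes k : measurable_fun setT (sign_changes k).
Proof.
apply: measurable_neg; apply: measurable_fun_eqr.
  by apply: measurableT_comp; [exact: measurable_sgr|exact: measurable_tuple_sum].
apply: measurableT_comp; first exact: measurable_sgr.
by apply: measurable_funB; [exact: measurable_tuple_sum|exact: measurable_tnth].
Qed.

Lemma measurable_sign_agreement k : measurable_fun setT (sign_agreement k).
Proof.
apply: measurable_funM.
  by apply: measurableT_comp; [exact: measurable_sgr|exact: measurable_tuple_sum].
by apply: measurableT_comp; [exact: measurable_sgr|exact: measurable_tnth].
Qed.

End tuple_signs.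

(** * The upper bound *)

Section sign_change.
Context (d : measure_display) (T : measurableType d) (R : realType)
  (P : probability T R) (X : nat -> {RV P >-> R}) (mu : probability R R).
Hypotheses (Xmu : iid_with_law X mu) (mu_sym : symmetric_law mu).

Local Notation signed := (signed_steps X).
Local Notation steps n := (signed_steps X (fun=> false) (@nat_of_ord n)).

Lemma Pr_signed n (e : 'I_n -> bool) (s : 'I_n -> nat) (b : n.-tuple R -> bool) :
  injective s -> measurable_fun setT b ->
  Pr P (fun t => b (signed e s t)) = Pr P (fun t => b (steps n t)).
Proof.
move=> s_inj mb; congr fine.
apply: (signed_steps_law Xmu mu_sym e (fun=> false) (B := [set x | b x])) => //.
  exact: ord_inj.
exact: measurable_pred_set.
Qed.

Lemma bounded_meas_signed n (e : 'I_n -> bool) (s : 'I_n -> nat)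
    (g : n.-tuple R -> R) : measurable_fun setT g ->
  (exists M, forall x, `|g x| <= M) ->
  bounded_meas (fun t => g (signed e s t)).
Proof.
move=> mg [M gM]; split; last by exists M.
by apply: measurableT_comp => //; exact: measurable_signed_steps.
Qed.

Lemma Ex_signed n (e : 'I_n -> bool) (s : 'I_n -> nat) (g : n.-tuple R -> R) :
  injective s -> measurable_fun setT g -> (exists M, forall x, `|g x| <= M) ->
  Ex P (fun t => g (signed e s t)) = Ex P (fun t => g (steps n t)).
Proof.
move=> s_inj mg gM; congr fine.
pose law (e : 'I_n -> bool) s : {mfun T >-> n.-tuple R} :=
  HB.pack (signed e s)
    (isMeasurableFun.Build _ _ _ _ _ (measurable_signed_steps X e s)).
have intE e' s' : (\int[P]_t (g (signed e' s' t))%:E =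
    \int[distribution P (law e' s')]_x (g x)%:E)%E.
  rewrite integral_distribution//; first exact/measurable_EFinP.
  by apply: bounded_meas_integrable; exact: bounded_meas_signed.
rewrite !intE; apply: eq_measure_integral => B mB _.
apply: (signed_steps_law Xmu mu_sym) => //; exact: ord_inj.
Qed.

(** Exchanging the indices k and ord_max moves step k to the last place and
    leaves the sum unchanged: this is how a statement on step k is transported
    to the last step. *)
Lemma signed_tperm m (k : 'I_m.+1) (e : 'I_m.+1 -> bool) (s : 'I_m.+1 -> nat) t :
  let p := tperm k ord_max in
  (tuple_sum (signed (e \o p) (s \o p) t) = tuple_sum (signed e s t)) *
  (tnth (signed (e \o p) (s \o p) t) ord_max = tnth (signed e s t) k).
Proof.
move=> p; split; last by rewrite !tnth_mktuple /= tpermR.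
rewrite /tuple_sum [RHS](reindex_inj (@perm_inj _ p)).
by apply: eq_bigr => i _; rewrite !tnth_mktuple.
Qed.

Lemma sign_change_probE m :
  sign_change_prob X m.+1 = Pr P (fun t => sign_changes ord_max (steps m.+1 t)).
Proof.
congr fine; congr (P _); apply/funext => t /=; congr (is_true (_ != _)).
  by congr Num.sg; apply: eq_bigr => i _; rewrite tnth_mktuple expr0 mul1r.
congr Num.sg; rewrite /tuple_sum big_ord_recr/= addrK.
by apply: eq_bigr => i _; rewrite tnth_mktuple expr0 mul1r.
Qed.

Lemma Pr_sign_changes m (k : 'I_m.+1) (e : 'I_m.+1 -> bool) :
  Pr P (fun t => sign_changes k (signed e (@nat_of_ord _) t)) =
  sign_change_prob X m.+1.
Proof.
rewrite sign_change_probE.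
rewrite -(@Pr_signed _ (e \o tperm k ord_max) (@nat_of_ord _ \o tperm k ord_max)).
- congr (Pr P _); apply/funext => t.
  by rewrite /sign_changes !signed_tperm.
- by move=> i j /ord_inj /perm_inj.
- exact: measurable_sign_changes.
Qed.

Lemma sign_agreement_bounded m (k : 'I_m.+1) :
  exists M : R, forall x, `|sign_agreement k x| <= M.
Proof.
exists 1 => x; rewrite normrM !normr_sg -natrM mulnb.
by case: (_ && _).
Qed.

Lemma Ex_sign_agreement m (k : 'I_m.+1) (e : 'I_m.+1 -> bool) :
  Ex P (fun t => sign_agreement k (signed e (@nat_of_ord _) t)) =
  Ex P (fun t => sign_agreement ord_max (steps m.+1 t)).
Proof.
rewrite -(@Ex_signed _ (e \o tperm k ord_max) (@nat_of_ord _ \o tperm k ord_max)).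
- congr (Ex P _); apply/funext => t.
  by rewrite /sign_agreement !signed_tperm.
- by move=> i j /ord_inj /perm_inj.
- exact: measurable_sign_agreement.
- exact: sign_agreement_bounded.
Qed.

(** Both sides are averaged over the sign of the last step, which does not change
    them; then sgr_flip_le applies pointwise. *)
Lemma sign_change_prob_le_agreement m :
  sign_change_prob X m.+1 <=
  Ex P (fun t => sign_agreement ord_max (steps m.+1 t)).
Proof.
pose e (i : 'I_m.+1) := i == ord_max.
have bch e' : bounded_meas
    (fun t => (sign_changes ord_max (signed e' (@nat_of_ord m.+1) t))%:R : R).
  apply: bounded_meas_pred; apply: measurableT_comp.
    exact: measurable_sign_changes.
  exact: measurable_signed_steps.
have bag e' : bounded_meas
    (fun t => sign_agreement ord_max (signed e' (@nat_of_ord m.+1) t)).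
  apply: bounded_meas_signed; first exact: measurable_sign_agreement.
  exact: sign_agreement_bounded.
rewrite -(ler_pM2l (ltr0Sn R 1)) !mulrDl !mul1r.
rewrite -[X in X + _ <= _](@Pr_sign_changes _ ord_max (fun=> false)).
rewrite -[X in _ + X <= _](@Pr_sign_changes _ ord_max e).
rewrite -[X in _ <= _ + X](@Ex_sign_agreement _ ord_max e).
rewrite -!Ex_pred; try (apply: measurableT_comp;
  [exact: measurable_sign_changes|exact: measurable_signed_steps]).
rewrite -!ExD//; apply: le_Ex; try exact: bounded_measD.
move=> t; set x := tnth (steps m.+1 t) ord_max.
set y := tuple_sum (steps m.+1 t) - x.
have xE : tnth (signed e (@nat_of_ord m.+1) t) ord_max = - x.
  by rewrite /x !tnth_mktuple /e eqxx expr1 expr0 mulN1r mul1r.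
have sE : tuple_sum (steps m.+1 t) = y + x by rewrite /y subrK.
have sE' : tuple_sum (signed e (@nat_of_ord m.+1) t) = y - x.
  rewrite /y /tuple_sum (bigD1 ord_max)//= xE [in RHS](bigD1 ord_max)//= -/x.
  rewrite addrC [x + _]addrC addrK; congr (_ - _); apply: eq_bigr => i im.
  by rewrite !tnth_mktuple /e (negbTE im).
rewrite /sign_changes /sign_agreement -/x -/y xE sE' opprK.
have -> : y - x + x = y by rewrite subrK.
rewrite sE; clearbody x y.
exact: sgr_flip_le.
Qed.

(** For i <> j, flipping the sign of step i alone shows that the expectation is
    its own opposite. *)
Lemma Ex_sgr_mul n (i j : 'I_n) :
  Ex P (fun t => Num.sg (tnth (steps n t) i) * Num.sg (tnth (steps n t) j)) <=
  (i == j)%:R.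
Proof.
pose g (x : n.-tuple R) : R := Num.sg (tnth x i) * Num.sg (tnth x j).
have mg : measurable_fun setT g.
  by apply: measurable_funM; (apply: measurableT_comp;
    [exact: measurable_sgr|exact: measurable_tnth]).
have g1 x : `|g x| <= 1.
  by rewrite normrM !normr_sg -natrM mulnb; case: (_ && _).
have gM : exists M : R, forall x, `|g x| <= M by exists 1.
have bg e : bounded_meas (fun t => g (signed e (@nat_of_ord n) t)).
  exact: bounded_meas_signed.
have [_|ij] := eqVneq i j.
  rewrite -[leRHS](Ex_cst P 1); apply: le_Ex.
  - exact: bg.
  - exact: bounded_meas_cst.
  - by move=> t; apply: (le_trans (ler_norm _)); exact: g1.
pose e k := k == i.
have := @Ex_signed n e (@nat_of_ord n) g (@ord_inj n) mg gM.
have -> : (fun t => g (signed e (@nat_of_ord n) t)) =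
    (fun t => -1 * g (steps n t)).
  apply/funext => t; rewrite /g !tnth_mktuple /e eqxx eq_sym (negbTE ij).
  by rewrite expr1 expr0 !mul1r !mulN1r sgrN mulNr.
rewrite ExZ; last exact: bg.
rewrite [leRHS](_ : _ = 0)// => h.
rewrite -[leLHS]/(Ex P (fun t => g (steps n t))); lra.
Qed.

(** By exchangeability n E[sgn S sgn X_n] = E[sgn S W], with W the sum of the
    signs of the steps, and the inequality 2 |W| <= W^2 / q + q with q = sqrt n
    replaces the Cauchy-Schwarz inequality. *)
Lemma sign_change_prob_le m :
  sign_change_prob X m.+1 <= (Num.sqrt m.+1%:R)^-1.
Proof.
apply: (le_trans (sign_change_prob_le_agreement m)).
set a := Ex _ _; set n : R := m.+1%:R; set q := Num.sqrt n.
have n_gt0 : 0 < n by rewrite ltr0n.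
have q_gt0 : 0 < q by rewrite sqrtr_gt0.
have q2 : q * q = n by rewrite -expr2 sqr_sqrtr// ltW.
pose w (t : T) := \sum_(i < m.+1) Num.sg (tnth (steps m.+1 t) i).
pose c (i j : 'I_m.+1) t :=
  Num.sg (tnth (steps m.+1 t) i) * Num.sg (tnth (steps m.+1 t) j).
have bsg (i : 'I_m.+1) : bounded_meas (fun t => Num.sg (tnth (steps m.+1 t) i)).
  apply: (@bounded_meas_signed _ _ _ (fun x => Num.sg (tnth x i))).
    by apply: measurableT_comp; [exact: measurable_sgr|exact: measurable_tnth].
  by exists 1 => x; rewrite normr_sg; case: (_ == _).
have bc i j : bounded_meas (c i j) by exact: bounded_measM.
have bag (k : 'I_m.+1) : bounded_meas (fun t => sign_agreement k (steps m.+1 t)).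
  apply: bounded_meas_signed; first exact: measurable_sign_agreement.
  exact: sign_agreement_bounded.
have wE t : w t ^+ 2 = \sum_i \sum_j c i j t.
  rewrite expr2 /w mulr_suml; apply: eq_bigr => i _.
  by rewrite mulr_sumr.
have bw2 : bounded_meas (fun t => \sum_i \sum_j c i j t).
  by apply: bounded_meas_sum => i; exact: bounded_meas_sum.
have Ew2 : Ex P (fun t => \sum_i \sum_j c i j t) <= n.
  rewrite Ex_sum; last by move=> i; exact: bounded_meas_sum.
  have -> : n = \sum_(i < m.+1) \sum_(j < m.+1) (i == j)%:R.
    rewrite (eq_bigr (fun=> 1)) ?sumr_const ?card_ord// => i _.
    by rewrite (bigD1 i)//= eqxx big1 ?addr0// => j /negbTE; rewrite eq_sym => ->.
  apply: ler_sum => i _; rewrite Ex_sum//; apply: ler_sum => j _.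
  exact: Ex_sgr_mul.
have : n * a <= (2 * q)^-1 * Ex P (fun t => \sum_i \sum_j c i j t) + q / 2.
  have -> : n * a =
      Ex P (fun t => \sum_(k < m.+1) sign_agreement k (steps m.+1 t)).
    rewrite Ex_sum// (eq_bigr (fun=> a)) ?sumr_const ?card_ord ?mulr_natl//.
    by move=> k _; exact: Ex_sign_agreement.
  rewrite -ExZ// -[X in _ <= _ + X](Ex_cst P) -ExD//; last 2 first.
  - by apply: bounded_measM => //; exact: bounded_meas_cst.
  - exact: bounded_meas_cst.
  apply: le_Ex.
  - exact: bounded_meas_sum.
  - apply: bounded_measD; last exact: bounded_meas_cst.
    by apply: bounded_measM => //; exact: bounded_meas_cst.
  move=> t; rewrite -wE -mulr_sumr -/(w t).
  have -> : (2 * q)^-1 * w t ^+ 2 + q / 2 = `|w t| + (2 * q)^-1 * (`|w t| - q) ^+ 2.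
    by rewrite -[w t ^+ 2]real_normK ?num_real//; field; rewrite gt_eqF.
  apply: (le_trans (ler_norm _)); rewrite normrM normr_sg.
  have: 0 <= (2 * q)^-1 * (`|w t| - q) ^+ 2.
    by rewrite mulr_ge0 ?sqr_ge0// invr_ge0 mulr_ge0// ltW.
  move=> h; apply: (@le_trans _ _ (1 * `|w t|)); last by rewrite mul1r; lra.
  by rewrite ler_wpM2r//; case: (_ != _).
have : (2 * q)^-1 * Ex P (fun t => \sum_i \sum_j c i j t) <= (2 * q)^-1 * n.
  by rewrite ler_wpM2l// invr_ge0 mulr_ge0// ltW.
have -> : (2 * q)^-1 * n = q / 2 by rewrite -q2; field; rewrite gt_eqF.
move=> h1 h2; have h3 : n * a <= q by lra.
by rewrite -(ler_pM2l n_gt0) (le_trans h3)// -q2 mulfK// gt_eqF.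
Qed.

End sign_change.

(** * The lower bound *)

Section sign_chain.
Context (R : realType).

(** S k is the sum after the first k signs have been flipped. Going from S k to
    S k.+1 passes through the sum without x k, so if neither half of any move
    changes the sign then S 0 and S m.+1 = - S 0 have the same sign. All sums are
    then 0, and x k is half the difference of two consecutive ones. *)
Lemma sign_chain m (x : nat -> R) :
  let S (k : nat) := \sum_(i < m.+1) (-1) ^+ (i < k)%N * x i in
  (forall k : 'I_m.+1,
    Num.sg (S k) = Num.sg (S k - (-1) ^+ (k < k)%N * x k) /\
    Num.sg (S k.+1) = Num.sg (S k.+1 - (-1) ^+ (k < k.+1)%N * x k)) ->
  forall k : 'I_m.+1, x k = 0.
Proof.
move=> S sgS.
have step (k : 'I_m.+1) : S k.+1 = S k - 2 * x k.
  rewrite /S (bigD1 k)//= [in RHS](bigD1 k)//= ltnn ltnSn expr0 expr1.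
  rewrite (eq_bigr (fun i : 'I_m.+1 => (-1) ^+ (i < k)%N * x i)); first by ring.
  move=> i ik; rewrite ltnS leq_eqVlt [X in X || _](_ : _ = false)//.
  exact: negbTE.
have sgS0 k : (k <= m.+1)%N -> Num.sg (S k) = Num.sg (S 0%N).
  elim: k => // k IHk km; rewrite -IHk; last exact: ltnW.
  have [/= -> ->] := sgS (Ordinal km).
  rewrite -/(S k) (step (Ordinal km)) /= ltnn ltnSn expr0 expr1; congr Num.sg.
  ring.
have SN : S m.+1 = - S 0%N.
  rewrite /S -sumrN; apply: eq_bigr => i _.
  by rewrite ltn_ord ltn0 expr1 expr0 mulN1r mul1r.
have S00 : S 0%N = 0.
  by have := sgS0 _ (leqnn _); rewrite SN sgrN => h; apply/eqP;
    rewrite -sgr_eq0; apply/eqP; lra.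
have S0 k : (k <= m.+1)%N -> S k = 0.
  by move=> /sgS0; rewrite S00 sgr0 => /eqP; rewrite sgr_eq0 => /eqP.
by move=> k; have := step k; rewrite !S0 => [h||]; [lra|exact: ltnW|].
Qed.

End sign_chain.

Section sign_change_lower_bound.
Context (d : measure_display) (T : measurableType d) (R : realType)
  (P : probability T R) (X : nat -> {RV P >-> R}) (mu : probability R R).
Hypotheses (Xmu : iid_with_law X mu) (mu_sym : symmetric_law mu).

Lemma tuple_sum_signed m (e : 'I_m.+1 -> bool) (s : 'I_m.+1 -> nat) t :
  tuple_sum (signed_steps X e s t) = \sum_(i < m.+1) (-1) ^+ e i * X (s i) t.
Proof. by apply: eq_bigr => i _; rewrite tnth_mktuple. Qed.

Lemma Pr_all_zero n :
  Pr P (fun t => [forall i : 'I_n, X i t == 0]) =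
  fine (P [set t | X 0%N t = 0]) ^+ n.
Proof.
have mP0 i : P [set t | X i t = 0] = mu [set 0].
  by have [_ lawX] := Xmu; exact: lawX.
rewrite mP0 /Pr.
have -> : [set t | [forall i : 'I_n, X i t == 0]] =
    [set t | forall i : 'I_n, [set (0 : R)] (X i t)].
  apply/seteqP; split=> t /=; first by move=> /forallP h i; exact/eqP.
  by move=> h; apply/forallP => i; exact/eqP.
rewrite (iid_box Xmu (A := fun=> [set 0]))//; last exact: ord_inj.
have /fineK <- : mu [set 0] \is a fin_num by exact: fin_num_measure.
by rewrite prodEFin prodr_const card_ord.
Qed.

(** By sign_chain the 2n events c (k, b) cover the event that some step is not
    zero; b tells which half of the move of step k is considered. *)
Lemma sign_change_prob_ge m :
  (2 * m.+1%:R)^-1 * (1 - fine (P [set t | X 0%N t = 0]) ^+ m.+1) <=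
  sign_change_prob X m.+1.
Proof.
rewrite -Pr_all_zero; set z := (fun t => [forall i : 'I_m.+1, X i t == 0]).
have mz : measurable_fun setT z.
  by apply: measurable_forall => i; exact: measurable_fun_eqr.
pose e k (i : 'I_m.+1) := (i < k)%N.
pose c (kb : 'I_m.+1 * bool) t :=
  sign_changes kb.1 (signed_steps X (e (kb.1 + kb.2)%N) (@nat_of_ord m.+1) t).
have mc kb : measurable_fun setT (c kb).
  apply: measurableT_comp; first exact: measurable_sign_changes.
  exact: measurable_signed_steps.
have z_sum t : (~~ z t)%:R <= \sum_kb (c kb t)%:R :> R.
  have [_|zt] := boolP (z t); first exact: sumr_ge0.
  have [[kb ckb]|/forallNP nc] := pselect (exists kb, c kb t).
    by rewrite (bigD1 kb)//= ckb lerDl sumr_ge0.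
  exfalso; move/negP: zt; apply; apply/forallP => k; apply/eqP.
  apply: (@sign_chain R m (fun i => X i t)) => {}k; split.
    have := nc (k, false); rewrite /c /= addn0 => /negP; rewrite negbK => /eqP.
    by rewrite tuple_sum_signed tnth_mktuple.
  have := nc (k, true); rewrite /c /= addn1 => /negP; rewrite negbK => /eqP.
  by rewrite tuple_sum_signed tnth_mktuple.
have : Pr P (fun t => ~~ z t) <= \sum_kb Pr P (c kb).
  by apply: Pr_le_sum => //; exact: measurable_neg.
have -> : Pr P (fun t => ~~ z t) = 1 - Pr P z.
  rewrite -!Ex_pred//; last exact: measurable_neg.
  rewrite -[X in _ = X - _](Ex_cst P) -mulN1r -ExZ; last exact: bounded_meas_pred.
  rewrite -ExD; [|exact: bounded_meas_cst|]; last first.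
    apply: bounded_measM; first exact: bounded_meas_cst.
    exact: bounded_meas_pred.
  by congr Ex; apply/funext => t; case: (z t) => /=; lra.
rewrite (eq_bigr (fun=> sign_change_prob X m.+1)); last first.
  by move=> kb _; exact: (Pr_sign_changes Xmu mu_sym).
rewrite sumr_const card_prod card_ord card_bool => zle.
rewrite ler_pdivrMl ?mulr_gt0 ?ltr0n//; apply: (le_trans zle).
by rewrite -[leLHS]mulr_natl natrM [_ * 2]mulrC.
Qed.

End sign_change_lower_bound.

(** * A symmetric law with very heavy tails *)

Section heavy_tailed_law.
Context (R : realType).

Let ltN11 : (-1 < 1 :> R). Proof. by lra. Qed.
Local Notation unif := (uniform_prob ltN11).

Lemma uniform_probE (A : set R) : measurable A ->
  unif A = ((2^-1)%:E * lebesgue_measure (A `&` `[(-1)%R, 1%R]%classic))%E.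
Proof.
move=> mA; rewrite [LHS]integral_uniform_pdf.
rewrite (eq_integral (fun=> (2^-1)%:E)).
  by rewrite integral_cst//; exact: measurableI.
move=> x; rewrite inE => -[_]; rewrite /= in_itv/= /uniform_pdf => ->.
by congr (_%:E); congr (_^-1); lra.
Qed.

Lemma uniform_prob_opp (A : set R) : measurable A ->
  unif (-%R @^-1` A) = unif A.
Proof.
move=> mA; have mNA : measurable (-%R @^-1` A).
  by rewrite -[X in measurable X]setTI; exact: oppr_measurable.
rewrite !uniform_probE//; congr (_ * _)%E.
rewrite -[RHS]lebesgue_measureN; last exact: measurableI.
congr lebesgue_measure; apply/seteqP.
by split=> x [Ax]; rewrite /= !in_itv/= => h; split=> //=; lra.
Qed.

Lemma uniform_prob_annulus (a b : R) : a <= b ->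
  (unif [set u | (a < `|u| <= b)%R] <= (b - a)%:E)%E.
Proof.
move=> ab; rewrite uniform_probE; last first.
  apply: measurable_pred_set; apply: measurable_and.
    by apply: measurable_fun_ltr => //; exact: normr_measurable.
  by apply: measurable_fun_ler => //; exact: normr_measurable.
apply: (@le_trans _ _ ((2^-1)%:E * (lebesgue_measure
    (`]a, b]%classic `|` `[(- b)%R, (- a)%R[%classic : set R))))%E.
  rewrite lee_wpmul2l ?lee_fin// le_measure ?inE//; last first.
  - move=> x [/= + _]; rewrite !in_itv/= => xab.
    have [x0|x0] := leP 0 x; [left|right]; move: xab.
      by rewrite ger0_norm.
    by rewrite ltr0_norm//; lra.
  - exact: measurableU.
  - apply: measurableI => //; apply: measurable_pred_set; apply: measurable_and.
      by apply: measurable_fun_ltr => //; exact: normr_measurable.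
    by apply: measurable_fun_ler => //; exact: normr_measurable.
apply: (@le_trans _ _ ((2^-1)%:E * ((b - a)%:E + (b - a)%:E)))%E; last first.
  by rewrite -EFinD -EFinM lee_fin; lra.
rewrite lee_wpmul2l ?lee_fin//.
apply: (le_trans (measureU2 _ _ _)) => //; apply: leeD.
- rewrite [leLHS]lebesgue_measure_itv/= lte_fin -EFinB.
  by case: ifP; rewrite lee_fin; lra.
- rewrite [leLHS]lebesgue_measure_itv/= lte_fin -EFinB.
  by case: ifP; rewrite lee_fin; lra.
Qed.

(** The exponent -10 makes the growth near 0 so steep that, for u at most
    n^(-1/2), moving away from 0 by n^(-4) divides the value by more than n; see
    steep_separation. *)
Definition steep (u : R) : R := Num.sg u * expR (`|u| `^ (- 10%:R)).

Definition steep_inv (x : R) : R := ln `|x| `^ (- 10%:R^-1).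

Lemma measurable_steep : measurable_fun setT steep.
Proof.
apply: measurable_funM; first exact: measurable_sgr.
apply: measurableT_comp => //.
by apply: (measurableT_comp (measurable_powR _)).
Qed.

Lemma measurable_steep_inv : measurable_fun setT steep_inv.
Proof.
apply: (measurableT_comp (measurable_powR _)).
by apply: measurableT_comp.
Qed.

Lemma norm_steep u : u != 0 -> `|steep u| = expR (`|u| `^ (- 10%:R)).
Proof.
by move=> u0; rewrite normrM normr_sg u0 mul1r ger0_norm// expR_ge0.
Qed.

Lemma steepK u : u != 0 -> steep_inv (steep u) = `|u|.
Proof.
move=> u0; rewrite /steep_inv norm_steep// expRK -powRrM mulrNN divff// powRr1//.
Qed.

Lemma steep_opp u : steep (- u) = - steep u.
Proof. by rewrite /steep normrN sgrN mulNr. Qed.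

(** The part of the line where psi reads off the height |u| of a point of the
    form steep u. *)
Definition steep_at (psi : R -> R) x :=
  (0 < psi x <= 1) && (`|x| == expR (psi x `^ (- 10%:R))).

Lemma measurable_steep_at psi :
  measurable_fun setT psi -> measurable_fun setT (steep_at psi).
Proof.
move=> mpsi; apply: measurable_and; first apply: measurable_and.
- exact: measurable_fun_ltr.
- exact: measurable_fun_ler.
- apply: measurable_fun_eqr; first exact: normr_measurable.
  apply: measurableT_comp => //.
  exact: (measurableT_comp (measurable_powR _)).
Qed.

(** What is needed of the law of steep U, for U uniform on [-1, 1]: almost surely
    |U| can be recovered as psi X, and it has density at most 1. *)
Lemma heavy_tailed_law :
  exists (mu : probability R R) (psi : R -> R),
  [/\ symmetric_law mu, measurable_fun setT psi,
      mu [set x | ~~ steep_at psi x] = 0%E &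
      forall a b, a <= b -> (mu [set x | (a < psi x <= b)%R] <= (b - a)%:E)%E].
Proof.
have msteep : measurable_fun (setT : set (measurableTypeR R)) steep.
  exact: measurable_steep.
pose phi : {mfun measurableTypeR R >-> R} :=
  HB.pack (steep : measurableTypeR R -> R)
    (isMeasurableFun.Build _ _ _ _ _ msteep).
have mN (b : R -> bool) : measurable_fun setT b ->
    measurable (steep @^-1` [set x | b x]).
  by move=> /measurable_pred_set mb; rewrite -[X in measurable X]setTI;
    exact: measurable_steep.
have mpsi := measurable_steep_inv.
have leb0 (A : set R) : measurable A -> A `<=` [set 0] ->
    lebesgue_measure A = 0%E.
  move=> mA A0; apply/eqP; rewrite eq_le measure_ge0 andbT.
  by rewrite -(lebesgue_measure_set1 (0 : R)) le_measure ?inE.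
have unif0 : unif [set 0] = 0%E.
  rewrite uniform_probE//; apply/eqP; rewrite mule_eq0; apply/orP; right.
  apply/eqP/leb0; first exact: measurableI.
  by move=> x [].
exists (distribution unif phi), steep_inv; split.
- move=> A mA; rewrite /pushforward /distribution /pushforward /=.
  have mphiA : measurable (steep @^-1` A).
    by rewrite -[X in measurable X]setTI; exact: measurable_steep.
  rewrite -[RHS]uniform_prob_opp//; congr (uniform_prob _ _).
  by apply/seteqP; split => u /=; rewrite steep_opp.
- exact: mpsi.
- pose b x := ~~ steep_at steep_inv x.
  have mb : measurable_fun setT b.
    by apply: measurable_neg; exact: measurable_steep_at.
  rewrite -[LHS]/(unif (steep @^-1` [set x | b x])).
  rewrite uniform_probE; last exact: mN.
  rewrite leb0 ?mule0//.
  + by apply: measurableI => //; exact: mN.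
  + move=> u [/=]; rewrite /b /steep_at in_itv/=; have [->//|u0] := eqVneq u 0.
    by rewrite steepK// norm_steep// eqxx andbT normr_gt0 u0/= ler_norml => /negP.
- move=> a b ab; rewrite /distribution /pushforward /=.
  have mab (f : R -> R) : measurable_fun setT f ->
      measurable_fun setT (fun u => (a < f u <= b)%R).
    move=> mf; apply: measurable_and; first exact: measurable_fun_ltr.
    exact: measurable_fun_ler.
  apply: (@le_trans _ _ (unif ([set u | (a < `|u| <= b)%R] `|` [set 0]))).
    rewrite le_measure ?inE//.
    + exact: (mN (fun x => (a < steep_inv x <= b)%R) (mab _ mpsi)).
    + apply: measurableU => //; apply: measurable_pred_set; apply: mab.
      exact: normr_measurable.
    + move=> u /=; have [->|u0] := eqVneq u 0; first by right.
      by rewrite steepK//; left.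
  apply: (le_trans (measureU2 _ _ _)) => //.
    by apply: measurable_pred_set; apply: mab; exact: normr_measurable.
  rewrite [X in (_ + X)%E]unif0 adde0; exact: uniform_prob_annulus.
Qed.

End heavy_tailed_law.

(** * The largest step dominates *)

Section domination.
Context (R : realType).

(** With a = 1/u and b = 1/v, the hypotheses give a - b >= a n^(-4), since b >= 1,
    and a^10 >= n^5, so that a^10 - b^10 >= a^9 (a - b) >= n; finally
    exp n > n. *)
Lemma steep_separation (n : nat) (u v : R) : (0 < n)%N ->
  0 < u -> u ^+ 2 * n%:R <= 1 -> v <= 1 -> u + (n%:R ^+ 4)^-1 <= v ->
  n%:R * expR (v `^ (- 10%:R)) < expR (u `^ (- 10%:R)).
Proof.
move=> n0 u0 un v1 uv; set r : R := n%:R in un uv *.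
have r0 : 0 < r by rewrite ltr0n.
have rN : 0 < (r ^+ 4)^-1 by rewrite invr_gt0 exprn_gt0.
have v0 : 0 < v by apply: lt_le_trans uv; rewrite addr_gt0.
rewrite !powR_invn ?(ltW u0) ?(ltW v0)// -!exprVn.
set a := u^-1; set b := v^-1.
have a0 : 0 < a by rewrite invr_gt0.
have b1 : 1 <= b by rewrite invf_ge1.
have b0 : 0 < b by rewrite invr_gt0.
have ra : r <= a ^+ 2.
  by rewrite /a exprVn -div1r ler_pdivlMr ?exprn_gt0// mulrC.
have abN : a * (r ^+ 4)^-1 <= a - b.
  have -> : a - b = (v - u) * a * b by rewrite /a /b; field; rewrite !gt_eqF.
  apply: (@le_trans _ _ ((v - u) * a)).
    by rewrite [leLHS]mulrC ler_wpM2r ?(ltW a0)//; lra.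
  by rewrite ler_peMr// mulr_ge0 ?(ltW a0)//; lra.
have ba : b <= a.
  by rewrite -subr_ge0; apply: le_trans abN; rewrite mulr_ge0 ?(ltW a0) ?(ltW rN).
have gap : r <= a ^+ 10 - b ^+ 10.
  have ab9 : b ^+ 9 <= a ^+ 9 by rewrite lerXn2r// nnegrE ?(ltW a0) ?(ltW b0).
  apply: (@le_trans _ _ (a ^+ 9 * (a - b))); last first.
    by rewrite mulrBr -exprSr [X in _ <= _ - X]exprSr lerB// ler_wpM2r// (ltW b0).
  apply: (@le_trans _ _ (a ^+ 9 * (a * (r ^+ 4)^-1))); last first.
    by rewrite ler_wpM2l// exprn_ge0// (ltW a0).
  rewrite mulrA -exprSr -ler_pdivrMr// invrK -exprS.
  by rewrite (exprM a 2 5) lerXn2r// nnegrE ?exprn_ge0 ?(ltW a0) ?(ltW r0).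
have -> : a ^+ 10 = (a ^+ 10 - b ^+ 10) + b ^+ 10 by rewrite subrK.
rewrite expRD ltr_pM2r ?expR_gt0//; apply: (lt_le_trans _ (expR_ge1Dx _)).
by apply: (le_lt_trans gap); rewrite ltrDr.
Qed.

Lemma sgr_dominated_sum n (Q : pred 'I_n) (x : 'I_n -> R) (k : 'I_n) :
  Q k -> (forall j, Q j -> j != k -> n%:R * `|x j| < `|x k|) -> x k != 0 ->
  Num.sg (\sum_(j | Q j) x j) = Num.sg (x k).
Proof.
move=> Qk xk xk0.
have n0 : 0 < n%:R :> R by rewrite ltr0n; case: n k {Q x Qk xk xk0} => [[]|].
have k0 : 0 < `|x k| by rewrite normr_gt0.
rewrite (bigD1 k)//=; set s := \sum_(_ | _) _.
have : n%:R * `|s| < n%:R * `|x k|.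
  apply: (@le_lt_trans _ _ (\sum_(j | Q j && (j != k)) n%:R * `|x j|)).
    by rewrite -mulr_sumr ler_wpM2l// ?(ltW n0)// ler_norm_sum.
  apply: (@le_lt_trans _ _ (\sum_(j | Q j && (j != k)) `|x k|)).
    by apply: ler_sum => j /andP[Qj jk]; apply/ltW/xk.
  rewrite sumr_const -[ltLHS]mulr_natl ltr_pM2r// ltr_nat.
  apply: (@leq_ltn_trans #|predC1 k|).
    by apply/subset_leq_card/fintype.subsetP => j /andP[].
  by rewrite cardC1 card_ord prednK//; case: n k {Q x Qk xk xk0 n0 k0 s} => [[]|].
rewrite ltr_pM2l// => sk.
have [xk_lt0|xk_gt0|xk00] := ltgtP (x k) 0; last by move/eqP: xk0.
- rewrite [RHS]ltr0_sg//; apply: ltr0_sg.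
  by move: sk; rewrite (ltr0_norm xk_lt0) ltr_norml; lra.
- rewrite [RHS]gtr0_sg//; apply: gtr0_sg.
  by move: sk; rewrite (gtr0_norm xk_gt0) ltr_norml; lra.
Qed.

(** The smallest u k over Q is at most n^(-1/2), and the other ones lie at least
    n^(-4) above it, so steep_separation applies to each of them. The predicate Q
    serves both for all steps and for all steps but the last. *)
Lemma exists_dominant n (Q : pred 'I_n) (x u : 'I_n -> R) :
  (forall i, 0 < u i <= 1) -> (forall i, `|x i| = expR (u i `^ (- 10%:R))) ->
  (forall i j, i != j -> (n%:R ^+ 4)^-1 <= `|u i - u j|) ->
  (exists2 i, Q i & u i ^+ 2 * n%:R <= 1) ->
  exists2 k, Q k & forall j, Q j -> j != k -> n%:R * `|x j| < `|x k|.
Proof.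
move=> u01 xu usep [i Qi ui].
have n0 : (0 < n)%N by case: n i {Q x u u01 xu usep Qi ui} => [[]|].
have [k Qk kmin] := arg_minP u Qi.
exists k => // j Qj jk; rewrite !xu.
have /andP[uk0 _] := u01 k; have /andP[_ uj1] := u01 j.
apply: steep_separation => //.
  apply: le_trans ui; rewrite ler_wpM2r// lerXn2r ?nnegrE ?(ltW uk0)//.
    by have /andP[/ltW] := u01 i.
  exact: kmin.
have := usep j k jk; rewrite ger0_norm; last by rewrite subr_ge0 kmin.
by rewrite lerBrDl.
Qed.

End domination.

(** * The heavy-tailed walk *)

Section independence.
Context (d : measure_display) (T : measurableType d) (R : realType)
  (P : probability T R) (X : nat -> {RV P >-> R}) (mu : probability R R).
Hypotheses (Xmu : iid_with_law X mu).

Lemma Pr_forall n (s : 'I_n -> nat) (b : 'I_n -> R -> bool) :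
  injective s -> (forall i, measurable_fun setT (b i)) ->
  Pr P (fun t => [forall i, b i (X (s i) t)]) = \prod_(i < n) Pr mu (b i).
Proof.
move=> s_inj mb; rewrite [LHS](_ : _ =
    fine (P [set t | forall i, [set x | b i x] (X (s i) t)])); last first.
  by congr (fine (P _)); apply/seteqP; split => t /= /forallP.
rewrite (iid_box Xmu (A := fun i => [set x | b i x]))//; last first.
  by move=> i; exact: measurable_pred_set.
rewrite (eq_bigr (fun i => (Pr mu (b i))%:E)) ?prodEFin// => i _.
by rewrite EFin_Pr.
Qed.

Lemma Pr_step i (b : R -> bool) : measurable_fun setT b ->
  Pr P (fun t => b (X i t)) = Pr mu b.
Proof.
move=> mb; have := @Pr_forall 1 (fun=> i) (fun=> b).
rewrite big_ord1 => <- //; last by move=> j k _; rewrite !ord1.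
congr (Pr P _); apply/funext => t; apply/idP/forallP => // h.
exact: (h ord0).
Qed.

Lemma Pr_pair i j (b c : R -> bool) : i != j ->
  measurable_fun setT b -> measurable_fun setT c ->
  Pr P (fun t => b (X i t) && c (X j t)) = Pr mu b * Pr mu c.
Proof.
move=> ij mb mc.
have := @Pr_forall 2 (fun k => if k == ord0 then i else j)
  (fun k => if k == ord0 then b else c).
rewrite big_ord_recl big_ord1/= => <-.
- congr (Pr P _); apply/funext => t; apply/idP/forallP => [/andP[bt ct] k|h].
    by case: ifP.
  by have := h ord0; have := h (lift ord0 ord0); rewrite /= => -> ->.
- move=> k l; case: (eqVneq k ord0) => [->|k0]; case: (eqVneq l ord0) => [->|l0] //.
  + by move=> e; rewrite e eqxx in ij.
  + by move=> e; rewrite e eqxx in ij.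
  + move=> _; apply/val_inj; case: k k0 => [[|[|//]] ? //=];
    by case: l l0 => [[|[|//]] ? //=].
- by move=> k; case: ifP.
Qed.

End independence.

Section opposed_leader.
Context (d : measure_display) (T : measurableType d) (R : realType)
  (P : probability T R) (X : nat -> {RV P >-> R}) (mu : probability R R).
Hypotheses (Xmu : iid_with_law X mu) (mu_sym : symmetric_law mu).
Variable m : nat.
Implicit Type x : m.+1.-tuple R.

Definition leader (k : 'I_m.+1) x :=
  [forall j, (j != k) ==> (`|tnth x j| < `|tnth x k|)].

(** Up to rare events, the only way in which the sign of a heavy-tailed walk
    changes at the last step. *)
Definition opposed_leader x :=
  leader ord_max x &&
  ((tuple_sum x - tnth x ord_max) * tnth x ord_max < 0).

Lemma measurable_leader k : measurable_fun setT (leader k).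
Proof.
apply: measurable_forall => j; case: (j != k) => /=; last exact: measurable_cst.
by apply: measurable_fun_ltr; apply: measurableT_comp => //; exact: measurable_tnth.
Qed.

Lemma measurable_opposed_leader : measurable_fun setT opposed_leader.
Proof.
apply: measurable_and; first exact: measurable_leader.
apply: measurable_fun_ltr => //; apply: measurable_funM.
  by apply: measurable_funB; [exact: measurable_tuple_sum|exact: measurable_tnth].
exact: measurable_tnth.
Qed.

Local Notation signed e := (signed_steps X e (@nat_of_ord m.+1)).

(** At most one step is a strict leader, and each is one with the same
    probability. *)
Lemma Pr_leader_le :
  Pr P (fun t => leader ord_max (signed (fun=> false) t)) <= m.+1%:R^-1.
Proof.
set p := Pr P _.
have Pr_leader k : Pr P (fun t => leader k (signed (fun=> false) t)) = p.
  rewrite /p -(Pr_signed Xmu mu_sym (fun=> false)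
    (s := @nat_of_ord _ \o tperm k ord_max)); last 2 first.
  - by move=> i j /ord_inj /perm_inj.
  - exact: measurable_leader.
  congr (Pr P _); apply/funext => t.
  have pE j l : (tperm k ord_max j == l) = (j == tperm k ord_max l).
    by rewrite -[l in LHS](tpermK k ord_max) (inj_eq perm_inj).
  apply/forallP/forallP => h j; have := h (tperm k ord_max j);
    rewrite !tnth_mktuple /= pE ?tpermK tpermL ?tpermR //.
have : \sum_(k < m.+1) Pr P (fun t => leader k (signed (fun=> false) t)) <= 1.
  apply: le_trans (Pr_le1 (b := fun=> true) P _); last exact: measurable_cst.
  apply: Pr_ge_sum => [|k|t]; first exact: measurable_cst.
    apply: measurableT_comp; first exact: measurable_leader.
    exact: measurable_signed_steps.
  have [[k lk]|nl] := pselect (exists k, leader k (signed (fun=> false) t)).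
    rewrite (bigD1 k)//= lk big1 ?addr0// => j jk.
    case: (boolP (leader j _)) => // /forallP/(_ k); rewrite eq_sym jk/= => kj.
    by move/forallP : lk => /(_ j); rewrite jk/= ltNge (ltW kj).
  rewrite big1// => k _; case: (boolP (leader k _)) => // lk.
  by exfalso; apply: nl; exists k.
rewrite (eq_bigr (fun=> p))// sumr_const card_ord -[leLHS]mulr_natl => h.
by rewrite -[leRHS]mulr1 ler_pdivlMl// ltr0n.
Qed.

(** Flipping the sign of the last step preserves its being a leader and makes it
    agree with the sum of the others, so at most half of the probability of being
    a leader remains. *)
Lemma Pr_opposed_leader_le :
  Pr P (fun t => opposed_leader (signed (fun=> false) t)) <= (2 * m.+1%:R)^-1.
Proof.
pose e (i : 'I_m.+1) := i == ord_max.
have mo e' : measurable_fun setT (fun t => opposed_leader (signed e' t)).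
  apply: measurableT_comp; first exact: measurable_opposed_leader.
  exact: measurable_signed_steps.
have ml : measurable_fun setT (fun t => leader ord_max (signed (fun=> false) t)).
  apply: measurableT_comp; first exact: measurable_leader.
  exact: measurable_signed_steps.
have Pe : Pr P (fun t => opposed_leader (signed e t)) =
    Pr P (fun t => opposed_leader (signed (fun=> false) t)).
  apply: (Pr_signed Xmu mu_sym e (@ord_inj _)).
  exact: measurable_opposed_leader.
suff : \sum_(b : bool)
    Pr P (fun t => opposed_leader (signed (if b then e else fun=> false) t)) <=
    m.+1%:R^-1.
  rewrite big_bool/= Pe => h; rewrite invfM.
  by move: (Pr P _) (m.+1%:R^-1) h => q r h; lra.
apply: le_trans Pr_leader_le; apply: Pr_ge_sum => // t.
rewrite big_bool/= {mo ml Pe}.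
have norm_e i : `|tnth (signed e t) i| = `|tnth (signed (fun=> false) t) i|.
  by rewrite !tnth_mktuple expr0 mul1r normrM normr_sign mul1r.
have le0 : leader ord_max (signed e t) = leader ord_max (signed (fun=> false) t).
  by apply/eq_forallb => i; rewrite !norm_e.
rewrite /opposed_leader le0; case: (leader _ _) => /=; last by rewrite addr0.
have xE : tnth (signed e t) ord_max = - tnth (signed (fun=> false) t) ord_max.
  by rewrite !tnth_mktuple /e eqxx expr1 expr0 mulN1r mul1r.
have sE : tuple_sum (signed e t) - tnth (signed e t) ord_max =
    tuple_sum (signed (fun=> false) t) - tnth (signed (fun=> false) t) ord_max.
  rewrite /tuple_sum (bigD1 ord_max)//= [in RHS](bigD1 ord_max)//=.
  rewrite ![_ ord_max + _]addrC !addrK; apply: eq_bigr => i im.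
  by rewrite !tnth_mktuple /e (negbTE im).
rewrite sE xE mulrN oppr_lt0; case: ltgtP => //= _; rewrite ?addr0 ?add0r//.
Qed.

End opposed_leader.

Section heavy_tailed_walk.
Context (d : measure_display) (T : measurableType d) (R : realType)
  (P : probability T R) (X : nat -> {RV P >-> R}) (mu : probability R R).
Hypotheses (Xmu : iid_with_law X mu) (mu_sym : symmetric_law mu).
Variable psi : R -> R.
Hypothesis mpsi : measurable_fun setT psi.
Let band (a b : R) x := a < psi x <= b.
Hypothesis mu_steep : mu [set x | ~~ steep_at psi x] = 0%E.
Hypothesis mu_band : forall a b, a <= b -> (mu [set x | band a b x] <= (b - a)%:E)%E.

(** The grid on ]0, 1] has n^4 cells, so that a union bound over the n^2 pairs of
    steps still gives o(1/n); delta = n^(-1/2) is the largest height to which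
    steep_separation applies. *)
Variable m : nat.
Hypothesis m_gt0 : (0 < m)%N.
Let n := m.+1.
Let r : R := n%:R.
Let N := (n ^ 4)%N.
Let NE : N%:R = r ^+ 4 :> R. Proof. by rewrite natrX. Qed.
Let r_gt0 : 0 < r. Proof. by rewrite ltr0n. Qed.
Let N_gt0 : 0 < N%:R :> R. Proof. by rewrite NE exprn_gt0. Qed.
Let delta : R := (Num.sqrt r)^-1.
Let sqr_gt0 : 0 < Num.sqrt r. Proof. by rewrite sqrtr_gt0. Qed.
Local Notation steps := (signed_steps X (fun=> false) (@nat_of_ord n)).

Lemma measurable_band a b : measurable_fun setT (band a b).
Proof.
by apply: measurable_and; [exact: measurable_fun_ltr|exact: measurable_fun_ler].
Qed.

Lemma Pr_band a b : a <= b -> 0 <= Pr mu (band a b) <= b - a.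
Proof.
by move=> ab; rewrite -!lee_fin EFin_Pr ?mu_band ?andbT//; last exact: measurable_band.
Qed.

Definition unsteep t := [exists i : 'I_n, ~~ steep_at psi (X i t)].

(** Step i lies in the cell c and step j in the same cell or in one of its two
    neighbours, so that outside these events distinct heights differ by at least
    1 / N. *)
Definition close (q : 'I_n * 'I_n * 'I_N) t :=
  let: (i, j, c) := q in
  (i != j) && (band (c%:R / N%:R) ((c%:R + 1) / N%:R) (X i t) &&
               band ((c%:R - 1) / N%:R) ((c%:R + 2) / N%:R) (X j t)).

(** Only the first m = n - 1 steps are considered: a small height among them
    serves for S_n and for S_(n-1) at the same time. *)
Definition no_small t := [forall j : 'I_m, band delta 1 (X j t)].

Lemma measurable_step (b : R -> bool) i :
  measurable_fun setT b -> measurable_fun setT (fun t => b (X i t)).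
Proof. by move=> mb; apply: measurableT_comp. Qed.

Lemma measurable_unsteep : measurable_fun setT unsteep.
Proof.
apply: measurable_exists => i.
apply: (measurable_step (b := fun x => ~~ steep_at psi x)); apply: measurable_neg.
exact: measurable_steep_at.
Qed.

Lemma measurable_close q : measurable_fun setT (close q).
Proof.
case: q => [[i j] c]; apply: measurable_and; first exact: measurable_cst.
by apply: measurable_and; apply: (measurable_step (b := band _ _));
  exact: measurable_band.
Qed.

Lemma measurable_no_small : measurable_fun setT no_small.
Proof.
apply: measurable_forall => j; apply: (measurable_step (b := band _ _)).
exact: measurable_band.
Qed.

Lemma Pr_unsteep : Pr P unsteep <= 0.
Proof.
have ms : measurable_fun setT (fun x => ~~ steep_at psi x).
  by apply: measurable_neg; exact: measurable_steep_at.
apply: (le_trans (Pr_exists_le P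
  (b := fun (i : 'I_n) t => ~~ steep_at psi (X i t)) _)) => [i|].
  exact: (measurable_step (b := fun x => ~~ steep_at psi x)).
rewrite big1// => i _.
rewrite (Pr_step Xmu i (b := fun x => ~~ steep_at psi x))//.
by rewrite /Pr mu_steep.
Qed.

(** There are n^2 N triples, each with probability at most (1 / N) (3 / N), and
    N = n^4. *)
Lemma Pr_close : Pr P (fun t => [exists q, close q t]) <= 3 / r ^+ 2.
Proof.
apply: (le_trans (Pr_exists_le P (b := close) _)) => [q|].
  exact: measurable_close.
apply: (@le_trans _ _ (\sum_(q : 'I_n * 'I_n * 'I_N) 3 / N%:R ^+ 2)).
  apply: ler_sum => -[[i j] c] _; rewrite /close.
  case: (eqVneq i j) => [_|ij] /=.
    rewrite /Pr (_ : [set t | false] = set0) ?measure0/= ?divr_ge0//.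
    by apply/seteqP; split.
  rewrite (Pr_pair Xmu (b := band _ _) (c := band _ _))//; try exact: measurable_band.
  have /Pr_band/andP[p0 p1] : c%:R / N%:R <= (c%:R + 1) / N%:R :> R.
    by rewrite ler_pM2r ?invr_gt0// lerDl.
  have /Pr_band/andP[q0 q1] : (c%:R - 1) / N%:R <= (c%:R + 2) / N%:R :> R.
    by rewrite ler_pM2r ?invr_gt0// lerD2l; lra.
  apply: (le_trans (ler_pM p0 q0 p1 q1)).
  by rewrite le_eqVlt; apply/orP; left; apply/eqP; field; rewrite gt_eqF.
rewrite sumr_const !card_prod !card_ord -[leLHS]mulr_natl.
rewrite (natrM _ (n * n) N) (natrM _ n n) NE -/r.
by rewrite le_eqVlt; apply/orP; left; apply/eqP; field; rewrite gt_eqF.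
Qed.

Lemma delta_le1 : delta <= 1.
Proof.
rewrite invf_le1// -[leLHS]sqrtr1 ler_sqrt ?ltr01//.
by rewrite ler1n.
Qed.

(** The probability is at most (1 - n^(-1/2))^m <= exp (- m n^(-1/2)), where
    m n^(-1/2) >= n^(1/2) / 2, and exp y >= y^4 / 4! gives the constant
    384 = 4! 2^4. *)
Lemma Pr_no_small : Pr P no_small <= 384%:R / r ^+ 2.
Proof.
rewrite (Pr_forall Xmu (s := @nat_of_ord m) (b := fun=> band delta 1)); last 2 first.
- exact: ord_inj.
- by move=> _; exact: measurable_band.
rewrite prodr_const card_ord.
have /andP[p0 p1] := Pr_band delta_le1.
apply: (@le_trans _ _ (expR (- delta) ^+ m)).
  rewrite lerXn2r ?nnegrE ?expR_ge0//; apply: (le_trans p1).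
  exact: expR_ge1Dx.
rewrite -expRM_natl mulrN expRN.
set y := _ * delta.
have ry : 0 < Num.sqrt r / 2 <= y.
  rewrite divr_gt0//= /y /delta ler_pdivlMr//.
  rewrite mulrAC -expr2 sqr_sqrtr ?(ltW r_gt0)// ler_pdivrMr//.
  rewrite -natrM ler_nat muln2 -addnn /n.
  by rewrite -addn1 leq_add2l.
have /andP[ry0 ry1] := ry.
have y0 : 0 < y by apply: lt_le_trans ry1.
have r4 : r ^+ 2 / 384%:R <= expR y.
  apply: le_trans (expR_ge1Dxn 3 (ltW y0)).
  have : (Num.sqrt r / 2) ^+ 4 <= y ^+ 4 by rewrite lerXn2r// nnegrE ltW.
  rewrite exprMn (exprM _ 2 2) sqr_sqrtr ?(ltW r_gt0)//.
  rewrite (_ : 4`!%:R = 24%:R)//.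
  move: (y ^+ 4) (r ^+ 2) => y4 r2; rewrite exprVn.
  rewrite (_ : 2 ^+ 4 = 16%:R); last by rewrite -natrX.
  lra.
have -> : 384%:R / r ^+ 2 = (r ^+ 2 / 384%:R)^-1 by rewrite invf_div.
have r2 : 0 < r ^+ 2 / 384%:R.
  by apply: divr_gt0; [exact: exprn_gt0 | rewrite ltr0n].
by rewrite lef_pV2 // posrE; exact: expR_gt0.
Qed.

Lemma cell_of (y : R) : 0 < y <= 1 ->
  exists c : 'I_N, c%:R / N%:R < y <= (c%:R + 1) / N%:R.
Proof.
move=> /andP[y0 y1].
have ex : exists k : nat, y * N%:R <= k%:R by exists N; rewrite ler_piMl// ltW.
have [k yk kmin] := ex_minnP ex.
have k0 : (0 < k)%N by rewrite -(ltr0n R); apply: lt_le_trans yk; rewrite mulr_gt0.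
have kN : (k.-1 < N)%N.
  by rewrite prednK// kmin// ler_piMl// ltW.
exists (Ordinal kN); rewrite /= ltr_pdivrMr// ler_pdivlMr//.
rewrite natr1 prednK// yk andbT ltNge; apply/negP => /kmin.
by rewrite -ltnS prednK// ltnn.
Qed.

(** Outside the exceptional events some step k dominates S_n and some step l
    among the first m dominates S_(n-1). If k is not the last step, it also
    dominates S_(n-1), and the two sums have the same sign. If it is the last
    one, S_n has the sign of the last step, which must then be opposite to
    S_(n-1). *)
Lemma sign_change_cases t : sign_changes ord_max (steps t) ->
  opposed_leader (steps t) ||
  (unsteep t || ([exists q, close q t] || no_small t)).
Proof.
apply: contraLR; rewrite !negb_or => /and4P[nopp nunst nclose nosmall].
have st (i : 'I_n) : steep_at psi (X i t).
  by move: nunst; rewrite negb_exists => /forallP/(_ i); rewrite negbK.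
pose x (i : 'I_n) := X i t; pose u (i : 'I_n) := psi (X i t).
have u01 i : 0 < u i <= 1 by have /andP[] := st i.
have xu i : `|x i| = expR (u i `^ (- 10%:R)) by have /andP[_ /eqP] := st i.
have x0 i : x i != 0 by rewrite -normr_gt0 xu expR_gt0.
have usep i j : i != j -> (n%:R ^+ 4)^-1 <= `|u i - u j|.
  move=> ij; rewrite -/r -NE.
  have [c /andP[c1 c2]] := cell_of (u01 i).
  move: nclose; rewrite negb_exists => /forallP/(_ (i, j, c)).
  rewrite /close ij/= {1}/band -/(u i) c1 c2/= /band -/(u j) negb_and -leNgt -ltNge.
  move: c1 c2; rewrite !mulrDl mul1r mulNr mul1r.
  rewrite ler_normr; set v := N%:R^-1; set w := _ * v => c1 c2.
  by case/orP => h; apply/orP; [left|right]; lra.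
(* An upper bound psi <= 1 holds for every step, so failing to lie in the band
   ]delta, 1] means being at most delta. *)
have [j0 j0small] : exists j : 'I_m, u (widen_ord (leqnSn m) j) <= delta.
  move: nosmall; rewrite negb_forall => /existsP[j]; rewrite /band.
  have /andP[_ uj1] := u01 (widen_ord (leqnSn m) j).
  by rewrite -[X in psi X]/(x (widen_ord (leqnSn m) j)) uj1 andbT -leNgt; exists j.
set i0 := widen_ord _ _ in j0small.
have i0m : i0 != ord_max by rewrite neq_ltn /= ltn_ord.
have ui0 : u i0 ^+ 2 * n%:R <= 1.
  have /andP[u0 _] := u01 i0.
  have : u i0 ^+ 2 <= delta ^+ 2.
    by rewrite lerXn2r// nnegrE ?(ltW u0)// (le_trans (ltW u0)).
  rewrite exprVn sqr_sqrtr ?(ltW r_gt0)// => ur.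
  by apply: (le_trans (ler_wpM2r (ltW r_gt0) ur)); rewrite mulVf ?gt_eqF.
have [k _ kdom] := @exists_dominant R n predT x u u01 xu usep
  (ex_intro2 _ _ i0 isT ui0).
have [l lm ldom] := @exists_dominant R n (predC1 ord_max) x u u01 xu usep
  (ex_intro2 _ _ i0 i0m ui0).
have totE : tuple_sum (steps t) = \sum_i x i.
  by apply: eq_bigr => i _; rewrite tnth_mktuple expr0 mul1r.
have maxE : tnth (steps t) ord_max = x ord_max.
  by rewrite tnth_mktuple expr0 mul1r.
have restE : tuple_sum (steps t) - x ord_max = \sum_(i | predC1 ord_max i) x i.
  by rewrite totE (bigD1 ord_max)//= addrAC subrr add0r.
have sgtot := sgr_dominated_sum (Q := predT) isT kdom (x0 k).
have sgrest := sgr_dominated_sum lm ldom (x0 l).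
rewrite /sign_changes maxE restE totE negbK sgtot.
have [km|km] := eqVneq k ord_max; last first.
  apply/eqP/esym/(sgr_dominated_sum (Q := predC1 ord_max)) => // j _.
  exact: kdom.
rewrite sgrest km; move: nopp; rewrite negb_and.
have -> /= : leader ord_max (steps t).
  apply/forallP => j; apply/implyP => jm; rewrite maxE.
  rewrite tnth_mktuple expr0 mul1r -/(x j) -km.
  apply: le_lt_trans (kdom j isT _); last by rewrite km.
  by rewrite ler_peMl// ler1n.
rewrite maxE restE -sgr_lt0 sgrM sgrest => h.
by rewrite (sgr_eq_of_mul_ge0 (x0 ord_max) (x0 l)) // mulrC.
Qed.

Lemma heavy_tailed_sign_change_prob_le :
  sign_change_prob X n <= (2 * r)^-1 + 387%:R / r ^+ 2.
Proof.
rewrite sign_change_probE.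
have mclo : measurable_fun setT (fun t => [exists q, close q t]).
  by apply: measurable_exists => q; exact: measurable_close.
have mopp : measurable_fun setT (fun t => opposed_leader (steps t)).
  apply: measurableT_comp; first exact: measurable_opposed_leader.
  exact: measurable_signed_steps.
have mchg : measurable_fun setT (fun t => sign_changes ord_max (steps t)).
  apply: measurableT_comp; first exact: measurable_sign_changes.
  exact: measurable_signed_steps.
have mrest := measurable_or mclo measurable_no_small.
have mbad := measurable_or measurable_unsteep mrest.
apply: le_trans (le_Pr P mchg (measurable_or mopp mbad) sign_change_cases) _.
apply: le_trans (Pr_or_le P mopp mbad) _.
apply: lerD; first exact: (Pr_opposed_leader_le Xmu mu_sym).
apply: le_trans (Pr_or_le P measurable_unsteep mrest) _.
have -> : 387%:R / r ^+ 2 = 0 + (3 / r ^+ 2 + 384%:R / r ^+ 2).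
  by rewrite add0r -mulrDl -natrD.
apply: lerD; first exact: Pr_unsteep.
apply: le_trans (Pr_or_le P mclo measurable_no_small) _.
by apply: lerD; [exact: Pr_close|exact: Pr_no_small].
Qed.

End heavy_tailed_walk.

Theorem proposition1 (R : realType) :
  (forall mu : probability R R, symmetric_law mu ->
    forall (d : measure_display) (T : measurableType d) (P : probability T R)
      (X : nat -> {RV P >-> R}), iid_with_law X mu ->
    (sign_change_prob X =O_\oo (fun n : nat => n%:R `^ (- 2^-1) : R)) /\
    (forall n : nat, (1 <= n)%N ->
      (2 * n%:R)^-1 * (1 - fine (P [set t | X 0%N t = 0]) ^+ n)
        <= sign_change_prob X n))
  /\
  (exists mu : probability R R, symmetric_law mu /\
    forall (d : measure_display) (T : measurableType d) (P : probability T R)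
      (X : nat -> {RV P >-> R}), iid_with_law X mu ->
    sign_change_prob X =
      (fun n : nat => ((2 * n%:R)^-1)%R) +o_\oo (fun n : nat => n%:R^-1 : R)).
Proof.
split.
  move=> mu mu_sym d T P X Xmu; split; last first.
    by case=> // m _; exact: (sign_change_prob_ge Xmu mu_sym).
  apply/eqO_exP; exists 1 => //; exists 1%N => //= -[//|m] _.
  rewrite mul1r powRN powR12_sqrt// [leRHS]ger0_norm ?invr_ge0//.
  rewrite ger0_norm; last exact: fine_ge0.
  exact: (sign_change_prob_le Xmu mu_sym).
have [mu [psi [mu_sym mpsi mu_steep mu_band]]] := heavy_tailed_law R.
exists mu; split=> // d T P X Xmu; apply/eqaddoP => eps eps0.
have mu0 : P [set t | X 0%N t = 0] = 0%E.
  have [_ lawX] := Xmu; rewrite [LHS](lawX 0%N [set 0])//.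
  apply/eqP; rewrite eq_le measure_ge0 andbT -mu_steep le_measure ?inE//.
    apply: measurable_pred_set; apply: measurable_neg.
    exact: measurable_steep_at.
  by move=> _ ->; rewrite /= /steep_at normr0 [0 == _]eq_sym gt_eqF ?expR_gt0// andbF.
(* The lower bound is part (a): the law has no atom at 0, so it reads 1/(2k). *)
have lo k : (0 < k)%N -> (2 * k%:R)^-1 <= sign_change_prob X k.
  case: k => // k _; have := sign_change_prob_ge Xmu mu_sym k.
  by rewrite mu0 /= expr0n subr0 mulr1.
have up k : (1 < k)%N ->
    sign_change_prob X k <= (2 * k%:R)^-1 + 387%:R / k%:R ^+ 2.
  by case: k => // k; exact: (heavy_tailed_sign_change_prob_le Xmu mu_sym mpsi).
near=> n.
have n1 : (1 < n)%N by near: n; exact: nbhs_infty_gt.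
have neps : 387%:R / eps <= n%:R by near: n; exact: nbhs_infty_ger.
have n0 := ltnW n1.
have r0 : 0 < n%:R :> R by rewrite ltr0n.
rewrite /= !fctE ger0_norm ?subr_ge0 ?lo//.
rewrite [X in _ <= _ * X]ger0_norm ?invr_ge0//.
rewrite lerBlDl; apply: (le_trans (up _ n1)); rewrite lerD2l.
rewrite expr2 invfM mulrA ler_pM2r ?invr_gt0// ler_pdivrMr//.
by rewrite mulrC -ler_pdivrMr.
Unshelve. all: by end_near.
Qed.
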